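(* Let $G$ be a discrete group and let $\mathcal{F}$ be a nonempty collection of subgroups of $G$ that is closed under conjugation and under taking subgroups. Suppose that $A$ and $B$ are fibrant objects of $\mathbf{S}_G^{\mathcal F}$, and let $f:A\to B$ be a $G$-map. If $f/H:A/H\to B/H$ is a weak equivalence of simplicial sets for each $H\in\mathcal F$, then the induced map on fixed points $f^H:A^H\to B^H$ is a weak equivalence of simplicial sets for each $H\in\mathcal F$.
   Context: Simplicial sets carry the Kan–Quillen model structure. $\mathbf{S}_G$ is the category of simplicial sets with a right $G$-action and $G$-equivariant simplicial maps. $\mathbf{S}_G^{\mathcal F}$ denotes $\mathbf{S}_G$ with the model structure (which exists) in which a $G$-map $f:X\to Y$ is a weak equivalence (resp. cofibration) if and only if the induced map on orbits $f/H:X/H\to Y/H$ is a weak equivalence (resp. cofibration, i.e. monomorphism) of simplicial sets for every $H\in\mathcal F$; fibrations are the maps with the right lifting property against all maps that are both cofibrations and weak equivalences. An object $X$ is fibrant if the map $X\to *$ to the terminal object is a fibration. $X^H$ denotes the simplicial subset of simplices fixed by $H$. *)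

(* Defs.v *)
From mathcomp Require Import all_boot.
From mathcomp Require Import boolp classical_sets.
From Stdlib Require Import Relations.Relation_Operators.

Set Implicit Arguments.
Unset Strict Implicit.
Unset Printing Implicit Defensive.

Local Open Scope classical_set_scope.
Local Open Scope group_scope.

(* The simplex category: the ordinal [n] = {0 < ... < n} is 'I_n.+1. *)
Record monotone (m n : nat) := Monotone {
  monotone_fun :> 'I_m.+1 -> 'I_n.+1;
  monotone_le : forall i j : 'I_m.+1,
    (i <= j)%N -> (monotone_fun i <= monotone_fun j)%N }.

Definition monotone_id (n : nat) : monotone n n :=
  @Monotone n n (fun i => i) (fun _ _ le_ij => le_ij).

Definition monotone_comp (m n p : nat) (a : monotone n p) (b : monotone m n) :
  monotone m p :=
  @Monotone m p (fun i => a (b i))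
    (fun _ _ le_ij => monotone_le a (monotone_le b le_ij)).

Definition monotone_const (m n : nat) (k : 'I_n.+1) : monotone m n :=
  @Monotone m n (fun=> k) (fun _ _ _ => leqnn k).

Record sset := SSet {
  simplices :> nat -> Type;
  restr : forall m n, monotone m n -> simplices n -> simplices m;
  restr_id : forall n (x : simplices n), restr (monotone_id n) x = x;
  restr_comp : forall m n p (a : monotone n p) (b : monotone m n)
    (x : simplices p),
    restr (monotone_comp a b) x = restr b (restr a x) }.

Record smap (X Y : sset) := SMap {
  smap_fun :> forall n, X n -> Y n;
  smap_restr : forall m n (a : monotone m n) (x : X n),
    smap_fun (restr a x) = restr a (smap_fun x) }.

Lemma smap_comp_restr (X Y Z : sset) (g : smap Y Z) (f : smap X Y)
    (m n : nat) (a : monotone m n) (x : X n) :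
  g m (f m (restr a x)) = restr a (g n (f n x)).
Proof. by rewrite !smap_restr. Qed.

Definition smap_comp (X Y Z : sset) (g : smap Y Z) (f : smap X Y) : smap X Z :=
  SMap (@smap_comp_restr X Y Z g f).

Definition smono (X Y : sset) (f : smap X Y) : Prop :=
  forall n, injective (f n).

Section SubSSet.
Variables (X : sset) (P : forall n, X n -> Prop).
Hypothesis P_restr : forall m n (a : monotone m n) (x : X n),
  P x -> P (restr a x).

Definition sub_restr m n (a : monotone m n) (x : {x : X n | P x}) :
  {x : X m | P x} :=
  exist _ (restr a (sval x)) (P_restr a (svalP x)).

Lemma sub_restr_id n (x : {x : X n | P x}) : sub_restr (monotone_id n) x = x.
Proof. by case: x => x Px; apply: eq_exist; apply: restr_id. Qed.

Lemma sub_restr_comp m n p (a : monotone n p) (b : monotone m n)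
    (x : {x : X p | P x}) :
  sub_restr (monotone_comp a b) x = sub_restr b (sub_restr a x).
Proof. by case: x => x Px; apply: eq_exist; apply: restr_comp. Qed.

Definition sub_sset : sset := SSet sub_restr_id sub_restr_comp.
End SubSSet.

Section ProdSSet.
Variables X Y : sset.

Definition prod_restr m n (a : monotone m n) (z : X n * Y n) : X m * Y m :=
  (restr a z.1, restr a z.2).

Lemma prod_restr_id n (z : X n * Y n) : prod_restr (monotone_id n) z = z.
Proof. by case: z => x y; rewrite /prod_restr !restr_id. Qed.

Lemma prod_restr_comp m n p (a : monotone n p) (b : monotone m n)
    (z : X p * Y p) :
  prod_restr (monotone_comp a b) z = prod_restr b (prod_restr a z).
Proof. by case: z => x y; rewrite /prod_restr !restr_comp. Qed.

Definition prod_sset : sset := SSet prod_restr_id prod_restr_comp.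
End ProdSSet.

Section StdSimplex.
Variable d : nat.

Lemma simplex_restr_id n (x : monotone n d) :
  monotone_comp x (monotone_id n) = x.
Proof. by case: x => f f_le; congr Monotone; apply: Prop_irrelevance. Qed.

Lemma simplex_restr_comp m n p (a : monotone n p) (b : monotone m n)
    (x : monotone p d) :
  monotone_comp x (monotone_comp a b) = monotone_comp (monotone_comp x a) b.
Proof. by congr Monotone; apply: Prop_irrelevance. Qed.

Definition simplex : sset :=
  @SSet (fun n => monotone n d) (fun _ _ a x => monotone_comp x a)
    simplex_restr_id simplex_restr_comp.
End StdSimplex.

Section Horn.
Variables (d : nat) (k : 'I_d.+1).

(* [x : [n] -> [d]] lies in a face opposite to some vertex j <> k. *)
Definition in_horn n (x : simplex d n) : Prop :=
  exists2 j : 'I_d.+1, j <> k & forall i, x i <> j.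

Lemma in_horn_restr m n (a : monotone m n) (x : simplex d n) :
  in_horn x -> in_horn (restr a x).
Proof. by case=> j jk xj; exists j => // i; apply: xj. Qed.

Definition horn : sset := sub_sset in_horn_restr.
End Horn.

Definition kan_complex (K : sset) : Prop :=
  forall (d : nat) (k : 'I_d.+2) (u : smap (horn k) K),
    exists v : smap (simplex d.+1) K,
      forall n (x : horn k n), v n (sval x) = u n x.

Definition elem_homotopic (X Y : sset) (u v : smap X Y) : Prop :=
  exists h : smap (prod_sset X (simplex 1)) Y,
    forall n (x : X n),
      h n (x, monotone_const n ord0) = u n x /\
      h n (x, monotone_const n ord_max) = v n x.

(* The equivalence relation on maps [X -> Y] whose classes are the elements of
   [X, Y], the set of components of the simplicial mapping space from [X] to
   [Y]. *)
Definition homotopic (X Y : sset) : smap X Y -> smap X Y -> Prop :=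
  clos_refl_sym_trans (smap X Y) (@elem_homotopic X Y).

(* [f] is a weak equivalence when f^* : [Y, K] -> [X, K] is bijective for every
   Kan complex K (the definition used by Joyal-Tierney and by Kerodon, equivalent
   to the geometric realization of f being a weak homotopy equivalence); the
   two clauses are the surjectivity and the injectivity of f^*. *)
Definition weak_equivalence (X Y : sset) (f : smap X Y) : Prop :=
  forall K : sset, kan_complex K ->
    (forall u : smap X K, exists v : smap Y K, homotopic (smap_comp v f) u) /\
    (forall v w : smap Y K,
       homotopic (smap_comp v f) (smap_comp w f) -> homotopic v w).

Definition is_subgroup (G : groupType) (H : set G) : Prop :=
  [/\ H 1, forall x y, H x -> H y -> H (x * y) & forall x, H x -> H x^-1].

Definition conj_set (G : groupType) (H : set G) (g : G) : set G :=
  [set h ^ g | h in H].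

Record gsset (G : groupType) := GSSet {
  gsset_sset :> sset;
  gact : forall n, gsset_sset n -> G -> gsset_sset n;
  gact1 : forall n (x : gsset_sset n), gact x 1 = x;
  gactM : forall n (x : gsset_sset n) (g h : G),
    gact x (g * h) = gact (gact x g) h;
  gact_restr : forall m n (a : monotone m n) (x : gsset_sset n) (g : G),
    gact (restr a x) g = restr a (gact x g) }.

Record gmap (G : groupType) (X Y : gsset G) := GMap {
  gmap_smap :> smap X Y;
  gmap_act : forall n (x : X n) (g : G),
    gmap_smap n (gact x g) = gact (gmap_smap n x) g }.

Section FixedPoints.
Variables (G : groupType) (H : set G).

Definition is_fixed (X : gsset G) n (x : X n) : Prop :=
  forall h, H h -> gact x h = x.

Lemma is_fixed_restr (X : gsset G) m n (a : monotone m n) (x : X n) :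
  is_fixed x -> is_fixed (restr a x).
Proof. by move=> Fx h Hh; rewrite gact_restr Fx. Qed.

Definition fixed_sset (X : gsset G) : sset := sub_sset (@is_fixed_restr X).

Variables (X Y : gsset G) (f : gmap X Y).

Lemma is_fixed_gmap n (x : X n) : is_fixed x -> is_fixed (f n x).
Proof. by move=> Fx h Hh; rewrite -gmap_act Fx. Qed.

Definition fixed_fun n (x : fixed_sset X n) : fixed_sset Y n :=
  exist _ (f n (sval x)) (is_fixed_gmap (svalP x)).

Lemma fixed_fun_restr m n (a : monotone m n) (x : fixed_sset X n) :
  fixed_fun (restr a x) = restr a (fixed_fun x).
Proof. by apply: eq_exist; apply: smap_restr. Qed.

Definition fixed_map : smap (fixed_sset X) (fixed_sset Y) :=
  SMap fixed_fun_restr.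
End FixedPoints.

(* The n-simplices of X/H are the H-orbits, as subsets of X_n. *)
Section Orbits.
Variables (G : groupType) (H : set G).

Definition gorbit (X : gsset G) n (x : X n) : set (X n) :=
  [set gact x h | h in H].

Definition orbit_simplices (X : gsset G) (n : nat) : Type :=
  {S : set (X n) | exists x, S = gorbit x}.

Lemma image_gorbit_restr (X : gsset G) m n (a : monotone m n) (S : set (X n)) :
  (exists x, S = gorbit x) -> exists y, [set restr a z | z in S] = gorbit y.
Proof.
case=> x ->; exists (restr a x); rewrite /gorbit image_comp.
by apply: eq_imagel => h _ /=; rewrite gact_restr.
Qed.

Definition orbit_restr (X : gsset G) m n (a : monotone m n)
    (S : orbit_simplices X n) : orbit_simplices X m :=
  exist _ [set restr a z | z in sval S] (image_gorbit_restr a (svalP S)).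

Lemma orbit_restr_id (X : gsset G) n (S : orbit_simplices X n) :
  orbit_restr (monotone_id n) S = S.
Proof.
case: S => S SO; apply: eq_exist => /=.
by rewrite -[RHS]image_id; apply: eq_imagel => x _; rewrite restr_id.
Qed.

Lemma orbit_restr_comp (X : gsset G) m n p (a : monotone n p)
    (b : monotone m n) (S : orbit_simplices X p) :
  orbit_restr (monotone_comp a b) S = orbit_restr b (orbit_restr a S).
Proof.
case: S => S SO; apply: eq_exist => /=.
by rewrite image_comp; apply: eq_imagel => x _ /=; rewrite restr_comp.
Qed.

Definition orbit_sset (X : gsset G) : sset :=
  SSet (@orbit_restr_id X) (@orbit_restr_comp X).

Variables (X Y : gsset G) (f : gmap X Y).

Lemma image_gorbit_gmap n (S : set (X n)) :
  (exists x, S = gorbit x) -> exists y, [set f n z | z in S] = gorbit y.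
Proof.
case=> x ->; exists (f n x); rewrite /gorbit image_comp.
by apply: eq_imagel => h _ /=; rewrite gmap_act.
Qed.

Definition orbit_fun n (S : orbit_sset X n) : orbit_sset Y n :=
  exist _ [set f n z | z in sval S] (image_gorbit_gmap (svalP S)).

Lemma orbit_fun_restr m n (a : monotone m n) (S : orbit_sset X n) :
  orbit_fun (restr a S) = restr a (orbit_fun S).
Proof.
apply: eq_exist => /=; rewrite !image_comp.
by apply: eq_imagel => x _ /=; rewrite smap_restr.
Qed.

Definition orbit_map : smap (orbit_sset X) (orbit_sset Y) :=
  SMap orbit_fun_restr.
End Orbits.

Section OrbitModelStructure.
Variables (G : groupType) (F : set (set G)).

Definition orbit_weq (X Y : gsset G) (f : gmap X Y) : Prop :=
  forall H, F H -> weak_equivalence (orbit_map H f).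

Definition orbit_cofibration (X Y : gsset G) (f : gmap X Y) : Prop :=
  forall H, F H -> smono (orbit_map H f).

Definition orbit_fibration (X Y : gsset G) (p : gmap X Y) : Prop :=
  forall (U V : gsset G) (i : gmap U V),
    orbit_cofibration i -> orbit_weq i ->
  forall (u : gmap U X) (v : gmap V Y),
    (forall n x, p n (u n x) = v n (i n x)) ->
  exists l : gmap V X,
    (forall n x, l n (i n x) = u n x) /\ (forall n y, p n (l n y) = v n y).
End OrbitModelStructure.

Definition terminal_sset : sset :=
  @SSet (fun=> unit) (fun _ _ _ x => x) (fun _ _ => erefl)
    (fun _ _ _ _ _ _ => erefl).

Definition terminal_gsset (G : groupType) : gsset G :=
  @GSSet G terminal_sset (fun _ x _ => x) (fun _ _ => erefl)
    (fun _ _ _ _ => erefl) (fun _ _ _ _ _ => erefl).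

Definition to_terminal (G : groupType) (X : gsset G) :
  gmap X (terminal_gsset G) :=
  @GMap G X (terminal_gsset G)
    (@SMap X terminal_sset (fun _ _ => tt) (fun _ _ _ _ => erefl))
    (fun _ _ _ => erefl).

Definition orbit_fibrant (G : groupType) (F : set (set G)) (X : gsset G) :
  Prop :=
  orbit_fibration F (to_terminal X).

(* Main.v *)
Require Import Defs.
From mathcomp Require Import all_boot.
From mathcomp Require Import boolp classical_sets.
From Stdlib Require Import Relations.Relation_Operators.

(* Every object is cofibrant, so a weak equivalence f between fibrant objects
   should be a G-homotopy equivalence for the cylinder X * Delta^1, on which G
   acts through X only; such homotopies restrict to fixed points.  Concretely,
   the inclusion i : A -> M(f) into the mapping cylinder is injective, hence an
   orbit cofibration, and an orbit weak equivalence because M(f) -> B is a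
   G-homotopy equivalence.  Extending id_A along i gives a left homotopy inverse
   g of f.  By two-out-of-three g is again an orbit weak equivalence, so g also
   has a left homotopy inverse, and f and g are mutually inverse up to
   G-homotopy. *)

Set Implicit Arguments.
Unset Strict Implicit.
Unset Printing Implicit Defensive.

Local Open Scope classical_set_scope.

(** * Extensionality, and the calculus of simplicial homotopies *)

Lemma monotone_eq (m n : nat) (a b : monotone m n) : a =1 b -> a = b.
Proof.
case: a b => a a_le [b b_le] /= /funext ab; case: b / ab b_le => b_le.
by congr Monotone; apply: Prop_irrelevance.
Qed.

Lemma smap_eq (X Y : sset) (u v : smap X Y) : (forall n, u n =1 v n) -> u = v.
Proof.
case: u v => u ur [v vr] /= uv.
have {}uv : u = v by apply: functional_extensionality_dep => n; apply: funext.
by case: v / uv vr => vr; congr SMap; apply: Prop_irrelevance.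
Qed.

Definition smap_id (X : sset) : smap X X :=
  @SMap X X (fun _ x => x) (fun _ _ _ _ => erefl).

Lemma smap_compA (X Y Z W : sset) (w : smap Z W) (v : smap Y Z)
    (u : smap X Y) :
  smap_comp w (smap_comp v u) = smap_comp (smap_comp w v) u.
Proof. exact: smap_eq. Qed.

Lemma smap_comp1 (X Y : sset) (u : smap X Y) : smap_comp u (smap_id X) = u.
Proof. exact: smap_eq. Qed.

Lemma homotopic_refl (X Y : sset) (u : smap X Y) : homotopic u u.
Proof. exact: rst_refl. Qed.

Lemma homotopic_sym (X Y : sset) (u v : smap X Y) :
  homotopic u v -> homotopic v u.
Proof. exact: rst_sym. Qed.

Lemma homotopic_trans (X Y : sset) (v u w : smap X Y) :
  homotopic u v -> homotopic v w -> homotopic u w.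
Proof. exact: rst_trans. Qed.

Lemma homotopic_map (X Y X' Y' : sset) (T : smap X Y -> smap X' Y') :
  (forall u v, elem_homotopic u v -> elem_homotopic (T u) (T v)) ->
  forall u v, homotopic u v -> homotopic (T u) (T v).
Proof.
move=> Thom u v; elim=> {u v} [u v uv|u|u v _|u v w _ uv _].
- exact/rst_step/Thom.
- exact: homotopic_refl.
- exact: homotopic_sym.
- exact: homotopic_trans.
Qed.

Lemma homotopic_compl (X Y Z : sset) (w : smap Y Z) (u v : smap X Y) :
  homotopic u v -> homotopic (smap_comp w u) (smap_comp w v).
Proof.
apply: homotopic_map => {}u {}v [h huv]; exists (smap_comp w h) => n x /=.
by have [-> ->] := huv n x.
Qed.

Lemma homotopic_compr (X Y Z : sset) (w : smap X Y) (u v : smap Y Z) :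
  homotopic u v -> homotopic (smap_comp u w) (smap_comp v w).
Proof.
apply: (homotopic_map (T := fun u => smap_comp u w)) => {}u {}v [h huv].
have hr m n (a : monotone m n) (z : prod_sset X (simplex 1) n) :
    h m (w m (restr a z).1, (restr a z).2) = restr a (h n (w n z.1, z.2)).
  by rewrite -smap_restr /= smap_restr.
by exists (SMap hr) => n x /=; apply: huv.
Qed.

(** * Weak equivalences: homotopy equivalences and cancellation *)

Section WeakEquivalence.
Variables X Y Z : sset.

(** On homotopy classes of maps into [K], precomposition with [g] is a two-sided inverse of
    precomposition with [f]. *)
Lemma homotopy_equivalence_weq (f : smap X Y) (g : smap Y X) :
  homotopic (smap_comp g f) (smap_id X) ->
  homotopic (smap_comp f g) (smap_id Y) -> weak_equivalence f.
Proof.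
move=> gf fg K _; split=> [u|v w vwf].
  exists (smap_comp u g).
  rewrite -smap_compA -[X in homotopic _ X]smap_comp1.
  exact: homotopic_compl.
have vfg (v' : smap Y K) : homotopic (smap_comp (smap_comp v' f) g) v'.
  rewrite -smap_compA -[X in homotopic _ X]smap_comp1.
  exact: homotopic_compl.
apply: homotopic_trans (homotopic_sym (vfg v)) _.
exact: homotopic_trans (homotopic_compr g vwf) (vfg w).
Qed.

(** On homotopy classes, precomposition with [smap_comp g f] is precomposition with [g] followed by
    precomposition with [f]. The composite and the first factor are bijective, hence so is the
    second. *)
Lemma weak_equivalence_cancell (f : smap X Y) (g : smap Y Z) :
  weak_equivalence g -> weak_equivalence (smap_comp g f) -> weak_equivalence f.
Proof.
move=> gW gfW K kanK.
have [g_surj _] := gW K kanK; have [gf_surj gf_inj] := gfW K kanK.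
split=> [u|v w vwf].
  by have [v] := gf_surj u; rewrite smap_compA; exists (smap_comp v g).
have [v' v'g] := g_surj v; have [w' w'g] := g_surj w.
apply: homotopic_trans (homotopic_sym v'g) _; apply: homotopic_trans (w'g).
apply/homotopic_compr/gf_inj; rewrite !smap_compA.
apply: homotopic_trans (homotopic_compr f v'g) _.
exact: homotopic_trans vwf (homotopic_sym (homotopic_compr f w'g)).
Qed.

(** The homotopy makes [g^*] a section of [f^*] on homotopy classes; a section of an injective map
    is its two-sided inverse. *)
Lemma weak_equivalence_left_inverse (f : smap X Y) (g : smap Y X) :
  weak_equivalence f -> homotopic (smap_comp g f) (smap_id X) ->
  weak_equivalence g.
Proof.
move=> fW gf K kanK; have [_ f_inj] := fW K kanK.
have ugf (u : smap X K) : homotopic (smap_comp (smap_comp u g) f) u.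
  rewrite -smap_compA -[X in homotopic _ X]smap_comp1.
  exact: homotopic_compl.
split=> [u|v w vwg].
  by exists (smap_comp u f); apply/f_inj/ugf.
apply: homotopic_trans (homotopic_sym (ugf v)) _.
exact: homotopic_trans (homotopic_compr f vwg) (ugf w).
Qed.

End WeakEquivalence.

(** * $G$-maps and $G$-homotopies *)

Section Equivariant.
Variable G : groupType.

Definition gmap_id (X : gsset G) : gmap X X :=
  @GMap G X X (smap_id X) (fun _ _ _ => erefl).

Lemma gmap_comp_act (X Y Z : gsset G) (w : gmap Y Z) (u : gmap X Y) n
    (x : X n) (g : G) :
  w n (u n (gact x g)) = gact (w n (u n x)) g.
Proof. by rewrite !gmap_act. Qed.

Definition gmap_comp (X Y Z : gsset G) (w : gmap Y Z) (u : gmap X Y) :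
  gmap X Z :=
  @GMap G X Z (smap_comp w u) (@gmap_comp_act X Y Z w u).

Lemma gmap_eq (X Y : gsset G) (u v : gmap X Y) :
  (forall n, u n =1 v n) -> u = v.
Proof.
case: u v => u ua [v va] /= /smap_eq uv.
by case: v / uv va => va; congr GMap; apply: Prop_irrelevance.
Qed.

Lemma gmap_compA (X Y Z W : gsset G) (w : gmap Z W) (v : gmap Y Z)
    (u : gmap X Y) :
  gmap_comp w (gmap_comp v u) = gmap_comp (gmap_comp w v) u.
Proof. exact: gmap_eq. Qed.

Lemma gmap_comp1 (X Y : gsset G) (u : gmap X Y) : gmap_comp u (gmap_id X) = u.
Proof. exact: gmap_eq. Qed.

Lemma gmap_1comp (X Y : gsset G) (u : gmap X Y) : gmap_comp (gmap_id Y) u = u.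
Proof. exact: gmap_eq. Qed.

(** Stating equivariance as a condition on a simplicial map avoids building the cylinder as a
    $G$-object. *)
Definition elem_ghomotopic (X Y : gsset G) (u v : gmap X Y) : Prop :=
  exists2 h : smap (prod_sset X (simplex 1)) Y,
    forall n (x : X n) (t : simplex 1 n) (g : G),
      h n (gact x g, t) = gact (h n (x, t)) g &
    forall n (x : X n),
      h n (x, monotone_const n ord0) = u n x /\
      h n (x, monotone_const n ord_max) = v n x.

Definition ghomotopic (X Y : gsset G) : gmap X Y -> gmap X Y -> Prop :=
  clos_refl_sym_trans (gmap X Y) (@elem_ghomotopic X Y).

Lemma ghomotopic_map (X Y X' Y' : gsset G) (T : gmap X Y -> gmap X' Y') :
  (forall u v, elem_ghomotopic u v -> elem_ghomotopic (T u) (T v)) ->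
  forall u v, ghomotopic u v -> ghomotopic (T u) (T v).
Proof.
move=> Thom u v; elim=> {u v} [u v uv|u|u v _|u v w _ uv _].
- exact/rst_step/Thom.
- exact: rst_refl.
- exact: rst_sym.
- exact: rst_trans.
Qed.

Lemma ghomotopic_compl (X Y Z : gsset G) (w : gmap Y Z) (u v : gmap X Y) :
  ghomotopic u v -> ghomotopic (gmap_comp w u) (gmap_comp w v).
Proof.
apply: ghomotopic_map => {}u {}v [h hg huv].
exists (smap_comp w h) => [n x t g|n x] /=.
  by rewrite hg gmap_act.
by have [-> ->] := huv n x.
Qed.

Lemma ghomotopic_compr (X Y Z : gsset G) (w : gmap X Y) (u v : gmap Y Z) :
  ghomotopic u v -> ghomotopic (gmap_comp u w) (gmap_comp v w).
Proof.
apply: (ghomotopic_map (T := fun u => gmap_comp u w)) => {}u {}v [h hg huv].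
have hr m n (a : monotone m n) (z : prod_sset X (simplex 1) n) :
    h m (w m (restr a z).1, (restr a z).2) = restr a (h n (w n z.1, z.2)).
  by rewrite -smap_restr /= smap_restr.
exists (SMap hr) => [n x t g|n x] /=; last exact: huv.
by rewrite gmap_act hg.
Qed.

Lemma homotopic_of_ghomotopic (X Y : gsset G) (X' Y' : sset)
    (T : gmap X Y -> smap X' Y') :
  (forall u v, elem_ghomotopic u v -> elem_homotopic (T u) (T v)) ->
  forall u v, ghomotopic u v -> homotopic (T u) (T v).
Proof.
move=> Thom u v; elim=> {u v} [u v uv|u|u v _|u v w _ uv _].
- exact/rst_step/Thom.
- exact: homotopic_refl.
- exact: homotopic_sym.
- exact: homotopic_trans.
Qed.

(** * Fixed points and orbits as homotopy-preserving functors *)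

Section Functors.
Variable H : set G.

Lemma fixed_map_id (X : gsset G) :
  fixed_map H (gmap_id X) = smap_id (fixed_sset H X).
Proof. by apply: smap_eq => n [x xH]; apply: eq_exist. Qed.

Lemma fixed_map_comp (X Y Z : gsset G) (w : gmap Y Z) (u : gmap X Y) :
  fixed_map H (gmap_comp w u) = smap_comp (fixed_map H w) (fixed_map H u).
Proof. by apply: smap_eq => n x; apply: eq_exist. Qed.

(** Since $G$ acts trivially on $\Delta^1$, $(X\times\Delta^1)^H = X^H\times\Delta^1$, so [h]
    restricts. *)
Lemma fixed_map_homotopic (X Y : gsset G) (u v : gmap X Y) :
  ghomotopic u v -> homotopic (fixed_map H u) (fixed_map H v).
Proof.
apply: homotopic_of_ghomotopic => {}u {}v [h hg huv].
have hfix n (z : prod_sset (fixed_sset H X) (simplex 1) n) :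
    is_fixed H (h n (sval z.1, z.2)).
  by move=> g Hg; rewrite -hg (svalP z.1).
pose k n z : fixed_sset H Y n := exist _ _ (@hfix n z).
have kr m n (a : monotone m n) z : k m (restr a z) = restr a (k n z).
  by apply: eq_exist; rewrite /= -smap_restr.
exists (SMap kr) => n x.
by split; apply: eq_exist; have [] := huv n (sval x).
Qed.

Lemma orbit_map_id (X : gsset G) :
  orbit_map H (gmap_id X) = smap_id (orbit_sset H X).
Proof. by apply: smap_eq => n [S SO]; apply: eq_exist; apply: image_id. Qed.

Lemma orbit_map_comp (X Y Z : gsset G) (w : gmap Y Z) (u : gmap X Y) :
  orbit_map H (gmap_comp w u) = smap_comp (orbit_map H w) (orbit_map H u).
Proof. by apply: smap_eq => n S; apply: eq_exist; rewrite /= image_comp. Qed.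

(** Likewise $(X\times\Delta^1)/H = X/H\times\Delta^1$: for fixed [t], equivariance makes [h] send
    orbits to orbits. *)
Lemma orbit_map_homotopic (X Y : gsset G) (u v : gmap X Y) :
  ghomotopic u v -> homotopic (orbit_map H u) (orbit_map H v).
Proof.
apply: homotopic_of_ghomotopic => {}u {}v [h hg huv].
have horb n (z : prod_sset (orbit_sset H X) (simplex 1) n) :
    exists y, [set h n (x, z.2) | x in sval z.1] = gorbit H y.
  case: z => -[S SO] t /=; case: SO => x ->; exists (h n (x, t)).
  by rewrite /gorbit image_comp; apply: eq_imagel => g _ /=; rewrite hg.
pose k n z : orbit_sset H Y n := exist _ _ (@horb n z).
have kr m n (a : monotone m n) z : k m (restr a z) = restr a (k n z).
  apply: eq_exist; rewrite /= !image_comp.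
  by apply: eq_imagel => x _ /=; rewrite -smap_restr.
exists (SMap kr) => n S.
by split; apply: eq_exist; apply: eq_imagel => x _; have [] := huv n x.
Qed.

(** Orbits are encoded as subsets, and a subset is recovered from its image under an injective
    map. *)
Lemma orbit_map_mono (X Y : gsset G) (u : gmap X Y) :
  smono u -> smono (orbit_map H u).
Proof.
move=> u_inj n [S SO] [S' S'O] /(congr1 sval)/= SS'; apply: eq_exist.
apply/seteqP; split=> x Sx; rewrite -(image_inj (@u_inj n)).
  by rewrite -SS'; exists x.
by rewrite SS'; exists x.
Qed.

Lemma fixed_map_weq (X Y : gsset G) (u : gmap X Y) (v : gmap Y X) :
  ghomotopic (gmap_comp v u) (gmap_id X) ->
  ghomotopic (gmap_comp u v) (gmap_id Y) -> weak_equivalence (fixed_map H u).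
Proof.
move=> /fixed_map_homotopic + /fixed_map_homotopic.
rewrite !fixed_map_comp !fixed_map_id; exact: homotopy_equivalence_weq.
Qed.

Lemma orbit_map_weq (X Y : gsset G) (u : gmap X Y) (v : gmap Y X) :
  ghomotopic (gmap_comp v u) (gmap_id X) ->
  ghomotopic (gmap_comp u v) (gmap_id Y) -> weak_equivalence (orbit_map H u).
Proof.
move=> /orbit_map_homotopic + /orbit_map_homotopic.
rewrite !orbit_map_comp !orbit_map_id; exact: homotopy_equivalence_weq.
Qed.

End Functors.

(** * Pointwise maximum of simplices of $\Delta^d$ *)

Definition monotone_max_fun (n d : nat) (s t : monotone n d) (i : 'I_n.+1) :
  'I_d.+1 := if (s i <= t i)%N then t i else s i.

Lemma monotone_max_funE (n d : nat) (s t : monotone n d) i :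
  monotone_max_fun s t i = maxn (s i) (t i) :> nat.
Proof. by rewrite /monotone_max_fun; case: leqP. Qed.

Lemma monotone_max_le (n d : nat) (s t : monotone n d) (i j : 'I_n.+1) :
  (i <= j)%N -> (monotone_max_fun s t i <= monotone_max_fun s t j)%N.
Proof.
move=> ij; rewrite !monotone_max_funE geq_max !leq_max.
by rewrite !(monotone_le _ ij) orbT.
Qed.

Definition monotone_max (n d : nat) (s t : monotone n d) : monotone n d :=
  Monotone (@monotone_max_le n d s t).

(** * The mapping cylinder and its homotopies *)

Section MappingCylinder.
Variables (A B : gsset G) (f : gmap A B).

(* The simplices lying over [cyl_time : [n] -> [1]] are those of B when
   [cyl_time] is constant at 1, and those of A otherwise; then [cyl_base] is
   determined as their image under f. *)
Record cyl (n : nat) := Cyl {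
  cyl_time : monotone n 1;
  cyl_base : B n;
  cyl_top : (exists i, cyl_time i = ord0) -> A n;
  cyl_topK : forall p, f n (cyl_top p) = cyl_base }.

(** The domain of [cyl_top] depends on [cyl_time]; comparing values at arbitrary proofs [p] and [q]
    avoids a transport. *)
Lemma cyl_eq n (x y : cyl n) :
  cyl_time x = cyl_time y -> cyl_base x = cyl_base y ->
  (forall p q, cyl_top (c := x) p = cyl_top (c := y) q) -> x = y.
Proof.
case: x y => [t b a ab] [t' b' a' ab'] /= tt' bb' aa'.
case: t' / tt' a' ab' aa' => a' ab' aa'; case: b' / bb' ab' => ab'.
have {}aa' : a = a' by apply: funext => p; apply: aa'.
by case: a' / aa' ab' => ab'; congr Cyl; apply: Prop_irrelevance.
Qed.

Lemma comp_hits0 m n (a : monotone m n) (t : monotone n 1) :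
  (exists i, monotone_comp t a i = ord0) -> exists i, t i = ord0.
Proof. by case=> i ta0; exists (a i). Qed.

Lemma cyl_restr_topK m n (a : monotone m n) (x : cyl n)
    (p : exists i, monotone_comp (cyl_time x) a i = ord0) :
  f m (restr a (cyl_top (c := x) (comp_hits0 p))) = restr a (cyl_base x).
Proof. by rewrite smap_restr cyl_topK. Qed.

Definition cyl_restr m n (a : monotone m n) (x : cyl n) : cyl m :=
  Cyl (@cyl_restr_topK m n a x).

Lemma cyl_restr_id n (x : cyl n) : cyl_restr (monotone_id n) x = x.
Proof.
apply: cyl_eq => /= [||p q]; [exact: monotone_eq | exact: restr_id |].
by rewrite restr_id; congr cyl_top; apply: Prop_irrelevance.
Qed.

Lemma cyl_restr_comp m n p (a : monotone n p) (b : monotone m n) (x : cyl p) :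
  cyl_restr (monotone_comp a b) x = cyl_restr b (cyl_restr a x).
Proof.
apply: cyl_eq => /= [||i j]; [exact: monotone_eq | exact: restr_comp |].
by rewrite restr_comp; congr (restr _ (restr _ (cyl_top _)));
  apply: Prop_irrelevance.
Qed.

Lemma cyl_act_topK n (x : cyl n) (g : G) p :
  f n (gact (cyl_top (c := x) p) g) = gact (cyl_base x) g.
Proof. by rewrite gmap_act cyl_topK. Qed.

Definition cyl_act n (x : cyl n) (g : G) : cyl n := Cyl (@cyl_act_topK n x g).

Lemma cyl_act1 n (x : cyl n) : cyl_act x 1%g = x.
Proof.
apply: cyl_eq => //= [|p q]; rewrite gact1 //.
by congr cyl_top; apply: Prop_irrelevance.
Qed.

Lemma cyl_actM n (x : cyl n) (g h : G) :
  cyl_act x (g * h)%g = cyl_act (cyl_act x g) h.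
Proof.
apply: cyl_eq => //= [|p q]; rewrite gactM //.
by congr (gact (gact (cyl_top _) _) _); apply: Prop_irrelevance.
Qed.

Lemma cyl_act_restr m n (a : monotone m n) (x : cyl n) (g : G) :
  cyl_act (cyl_restr a x) g = cyl_restr a (cyl_act x g).
Proof.
apply: cyl_eq => //= [|p q]; rewrite gact_restr //.
by congr (restr _ (gact (cyl_top _) _)); apply: Prop_irrelevance.
Qed.

Definition mapping_cyl : gsset G :=
  @GSSet G (SSet cyl_restr_id cyl_restr_comp) cyl_act cyl_act1 cyl_actM
    cyl_act_restr.

(** The canonical map $A\times\Delta^1\to M(f)$. Over the constant 1 the domain of [cyl_top] is
    empty, so there only the image under [f] is remembered. *)
Definition cyl_of_prod n (z : prod_sset A (simplex 1) n) : mapping_cyl n :=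
  @Cyl n z.2 (f n z.1) (fun=> z.1) (fun=> erefl).

Lemma cyl_of_prod_restr m n (a : monotone m n) z :
  cyl_of_prod (restr a z) = restr a (cyl_of_prod z).
Proof. by apply: cyl_eq => //=; rewrite smap_restr. Qed.

Lemma cyl_of_prod_act n (x : A n) (t : simplex 1 n) (g : G) :
  cyl_of_prod (gact x g, t) = gact (cyl_of_prod (x, t)) g.
Proof. by apply: cyl_eq => //=; rewrite gmap_act. Qed.

Lemma cyl_inl_restr m n (a : monotone m n) (x : A n) :
  cyl_of_prod (restr a x, monotone_const m ord0) =
  restr a (cyl_of_prod (x, monotone_const n ord0)).
Proof.
by rewrite -cyl_of_prod_restr; congr (cyl_of_prod (_, _)); apply: monotone_eq.
Qed.

Definition cyl_inl : gmap A mapping_cyl :=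
  @GMap G A mapping_cyl (SMap cyl_inl_restr)
    (fun n x g => cyl_of_prod_act x (monotone_const n ord0) g).

Lemma const1_not0 n : ~ exists i, monotone_const n (@ord_max 1) i = ord0.
Proof. by case=> i /(congr1 val). Qed.

Definition cyl_inr_fun n (y : B n) : mapping_cyl n :=
  @Cyl n (monotone_const n ord_max) y (fun p => False_rect _ (const1_not0 p))
    (fun p => False_ind _ (const1_not0 p)).

Lemma cyl_inr_restr m n (a : monotone m n) (y : B n) :
  cyl_inr_fun (restr a y) = restr a (cyl_inr_fun y).
Proof. by apply: cyl_eq => //= p; case: const1_not0. Qed.

Lemma cyl_inr_act n (y : B n) (g : G) :
  cyl_inr_fun (gact y g) = gact (cyl_inr_fun y) g.
Proof. by apply: cyl_eq => //= p; case: const1_not0. Qed.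

Definition cyl_inr : gmap B mapping_cyl :=
  @GMap G B mapping_cyl (SMap cyl_inr_restr) cyl_inr_act.

Definition cyl_proj : gmap mapping_cyl B :=
  @GMap G mapping_cyl B
    (@SMap mapping_cyl B cyl_base (fun _ _ _ _ => erefl)) (fun _ _ _ => erefl).

(** Over the constant 0 the component [cyl_top] is available and returns the original simplex of
    [A]. *)
Lemma cyl_inl_mono : smono cyl_inl.
Proof.
move=> n x y /= xy.
(* Generalizing over [z] allows the equation to be used although the type of [p] depends on [z]. *)
have top0 (z : mapping_cyl n) :
    z = cyl_inl n x -> forall p, cyl_top (c := z) p = x.
  by move=> ->.
have hit0 : exists i, cyl_time (cyl_inl n y) i = ord0 by exists ord0.
by rewrite -(top0 _ (esym xy) hit0).
Qed.

Lemma max_hits0 n (s t : monotone n 1) :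
  (exists i, monotone_max s t i = ord0) -> exists i, s i = ord0.
Proof.
case=> i /(congr1 val) /=; rewrite monotone_max_funE => st0.
exists i; apply: val_inj => /=; apply/eqP.
by rewrite -leqn0 -[X in (_ <= X)%N]st0 leq_maxl.
Qed.

(** The deformation of $M(f)$ onto $B$: time is replaced by its maximum with the homotopy parameter,
    which is the old time at 0 and constantly 1 at 1. *)
Definition cyl_push n (z : prod_sset mapping_cyl (simplex 1) n) :
  mapping_cyl n :=
  @Cyl n (monotone_max (cyl_time z.1) z.2) (cyl_base z.1)
    (fun p => cyl_top (max_hits0 p)) (fun p => cyl_topK (max_hits0 p)).

Lemma cyl_push_restr m n (a : monotone m n) z :
  cyl_push (restr a z) = restr a (cyl_push z).
Proof.
apply: cyl_eq => /= [||p q]; [exact: monotone_eq | by [] |].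
by congr (restr _ (cyl_top _)); apply: Prop_irrelevance.
Qed.

Lemma cyl_proj_inr : gmap_comp cyl_proj cyl_inr = gmap_id B.
Proof. exact: gmap_eq. Qed.

Lemma cyl_inr_proj :
  ghomotopic (gmap_comp cyl_inr cyl_proj) (gmap_id mapping_cyl).
Proof.
(* The deformation starts at the identity, hence the symmetry. *)
apply/rst_sym/rst_step; exists (SMap cyl_push_restr) => [n x t g|n x] /=.
  apply: cyl_eq => //= p q.
  by congr (gact (cyl_top _) _); apply: Prop_irrelevance.
split; (apply: cyl_eq => //=; [|move=> p q]).
- apply: monotone_eq => i; apply: val_inj.
  by rewrite /= monotone_max_funE maxn0.
- by congr cyl_top; apply: Prop_irrelevance.
- apply: monotone_eq => i; apply: val_inj; rewrite /= monotone_max_funE /=.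
  by apply/maxn_idPr; rewrite -ltnS.
- by case: const1_not0.
Qed.

Lemma cyl_proj_inl : gmap_comp cyl_proj cyl_inl = f.
Proof. exact: gmap_eq. Qed.

(** The canonical map from $A\times\Delta^1$ is itself the homotopy. *)
Lemma cyl_inl_ghomotopic : ghomotopic cyl_inl (gmap_comp cyl_inr f).
Proof.
apply: rst_step; exists (SMap cyl_of_prod_restr) => [|n x].
  exact: cyl_of_prod_act.
by split; apply: cyl_eq => //= p q; case: const1_not0.
Qed.

End MappingCylinder.

(** * Weak equivalences between fibrant objects are $G$-homotopy equivalences *)

Variable F : set (set G).

Lemma fibrant_left_inverse (A B : gsset G) (f : gmap A B) :
  orbit_fibrant F A -> orbit_weq F f ->
  exists g : gmap B A, ghomotopic (gmap_comp g f) (gmap_id A).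
Proof.
move=> A_fib f_weq.
have inl_cof : orbit_cofibration F (cyl_inl f).
  by move=> H _; apply/orbit_map_mono/cyl_inl_mono.
have inl_weq : orbit_weq F (cyl_inl f).
  move=> H FH.
  (* Cancel the projection to [B], a $G$-homotopy equivalence whose composite with the inclusion is
     [f]. *)
  apply: (@weak_equivalence_cancell _ _ _ _ (orbit_map H (cyl_proj f))).
    apply: (orbit_map_weq _ (cyl_inr_proj f)).
    by rewrite cyl_proj_inr; apply: rst_refl.
  by rewrite -orbit_map_comp cyl_proj_inl; apply: f_weq.
(* The square over the terminal object commutes trivially, so the lift [r] is a retraction of $M(f)$
   onto [A]. *)
have [r [rK _]] := A_fib _ _ _ inl_cof inl_weq (gmap_id A)
  (to_terminal (mapping_cyl f)) (fun _ _ => erefl).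
exists (gmap_comp r (cyl_inr f)).
(* With the identity written as [r] after [cyl_inl f], it remains to apply [r] to the homotopy
   between the two ends of the cylinder. *)
have <- : gmap_comp r (cyl_inl f) = gmap_id A by apply: gmap_eq.
by rewrite -gmap_compA; apply/rst_sym/ghomotopic_compl/cyl_inl_ghomotopic.
Qed.

Lemma fibrant_homotopy_equivalence (A B : gsset G) (f : gmap A B) :
  orbit_fibrant F A -> orbit_fibrant F B -> orbit_weq F f ->
  exists2 g : gmap B A, ghomotopic (gmap_comp g f) (gmap_id A) &
    ghomotopic (gmap_comp f g) (gmap_id B).
Proof.
move=> A_fib B_fib f_weq; have [g gf] := fibrant_left_inverse A_fib f_weq.
have g_weq : orbit_weq F g.
  move=> H FH; apply: weak_equivalence_left_inverse (f_weq H FH) _.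
  by rewrite -orbit_map_comp -orbit_map_id; apply: orbit_map_homotopic.
have [f' f'g] := fibrant_left_inverse B_fib g_weq.
(* The usual monoid argument: $f \sim f'gf \sim f'$, whence $fg \sim f'g \sim \mathrm{id}_B$. *)
have f'gf : ghomotopic (gmap_comp (gmap_comp f' g) f) f.
  by rewrite -[X in ghomotopic _ X]gmap_1comp; apply: ghomotopic_compr.
have f'_f : ghomotopic (gmap_comp (gmap_comp f' g) f) f'.
  rewrite -gmap_compA -[X in ghomotopic _ X]gmap_comp1.
  exact: ghomotopic_compl.
exists g => //; apply: rst_trans f'g; apply: ghomotopic_compr.
exact: rst_trans (rst_sym _ _ _ _ f'gf) f'_f.
Qed.

End Equivariant.

Unset Implicit Arguments.

Theorem corollary3p5 (G : groupType) (F : set (set G))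
    (F_nonempty : F !=set0)
    (F_subgroup : forall H, F H -> is_subgroup H)
    (F_conj : forall H g, F H -> F (conj_set H g))
    (F_sub : forall H K, F H -> is_subgroup K -> K `<=` H -> F K)
    (A B : gsset G) (A_fibrant : orbit_fibrant F A)
    (B_fibrant : orbit_fibrant F B) (f : gmap A B)
    (f_weq : forall H, F H -> weak_equivalence (orbit_map H f)) :
  forall H, F H -> weak_equivalence (fixed_map H f).
Proof.
have [g gf fg] := fibrant_homotopy_equivalence A_fibrant B_fibrant f_weq.
by move=> H _; apply: fixed_map_weq gf fg.
Qed.
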